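(* Let $\kappa$ be a regular uncountable cardinal and $\lambda\ge\kappa$. Let $\mathcal{E}\subseteq\mathcal{E}'$ be filters on $[\lambda]^{<\kappa}$ extending $\mathcal{E}_{\lambda,\kappa}$, let $\langle\mathcal{C}_\zeta:\zeta<\mu\rangle$ list a subset of $\mathcal{E}'$ which generates a filter extending $\mathcal{E}$, and let $\langle a_\zeta:\zeta<\mu\rangle$ be a sequence of subsets of $\lambda$, each of cardinality $<\kappa$, such that for every cardinal $\chi>\lambda$ and every $x\in\mathcal{H}(\chi)$ the set $\{N\cap\lambda: N\prec(\mathcal{H}(\chi),\in),\ x\in N,\ |N|<\kappa,\ N\cap\kappa\in\kappa,\ (\forall\zeta<\mu)[a_\zeta\subseteq N\Rightarrow N\cap\lambda\in\mathcal{C}_\zeta]\}$ belongs to $\mathcal{E}'$. Then some member $\mathcal{C}^*$ of $\mathcal{E}'$ contains no unbounded subset which is $=\emptyset\ \mathrm{mod}\ \mathcal{E}$.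
   Context: $[\lambda]^{<\kappa}$ is the set of subsets of $\lambda$ of cardinality $<\kappa$. $\mathcal{H}(\chi)$ is the family of sets whose transitive closure has cardinality $<\chi$. For a model $\mathcal{M}$ with universe $\lambda$ and countable vocabulary, $\mathrm{cl}_{\mathcal{M}}(a)$ is the closure of $a$ under the functions of $\mathcal{M}$; a club of $[\lambda]^{<\kappa}$ is a set $\{a\in[\lambda]^{<\kappa}: a=\mathrm{cl}_{\mathcal{M}}(a),\ a\cap\kappa\in\kappa\}$ for such $\mathcal{M}$, and $\mathcal{E}_{\lambda,\kappa}$ is the filter generated by the clubs. A set $\mathcal{U}\subseteq[\lambda]^{<\kappa}$ is $=\emptyset\ \mathrm{mod}\ \mathcal{E}$ if $[\lambda]^{<\kappa}\setminus\mathcal{U}\in\mathcal{E}$. A set $\mathcal{U}\subseteq[\lambda]^{<\kappa}$ is unbounded if every member of $[\lambda]^{<\kappa}$ is contained in some member of $\mathcal{U}$. *)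

(* Defs.v *)
From HB Require Import structures.
From mathcomp Require Import all_boot all_classical.

Set Implicit Arguments.
Unset Strict Implicit.
Unset Printing Implicit Defensive.

Local Open Scope classical_set_scope.
Local Open Scope card_scope.

(* The set-theoretic universe V: Aczel's well-founded trees modulo
   extensional equality.  The quotient is realised by equivalence classes, so
   that Leibniz equality on V is equality of sets.  With the axioms of boolp,
   V is a model of ZFC. *)
Inductive tree : Type := Tree (X : Type) of (X -> tree).

Fixpoint tree_eq (s t : tree) : Prop :=
  match s, t with
  | Tree X f, Tree Y g =>
      (forall i, exists j, tree_eq (f i) (g j)) /\
      (forall j, exists i, tree_eq (f i) (g j))
  end.

Definition tree_in (s t : tree) : Prop :=
  match t with Tree Y g => exists j, tree_eq s (g j) end.

Record V : Type := MkV {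
  V_class : set tree;
  V_classP : exists t, V_class = [set s | tree_eq t s] }.

Definition memV (x y : V) : Prop :=
  exists s t, [/\ V_class x s, V_class y t & tree_in s t].

Notation "x ∈ y" := (memV x y) (at level 70, no associativity).

(* A class is an element of [set V].  Every subclass of a set, and every class
   equipollent to a set, is the extension of an element of V; hence sets of
   sets are encoded below by [set (set V)], and sequences by functions. *)
Definition ext (y : V) : set V := [set x | x ∈ y].

Definition transitive_class (A : set V) : Prop :=
  forall x, A x -> ext x `<=` A.

Definition card_lt T U (A : set T) (B : set U) : Prop :=
  (A #<= B) /\ ~ (B #<= A).

Notation "A '#<' B" := (card_lt A B) (at level 79) : card_scope.

(* von Neumann ordinals: membership is the strict order, inclusion the weak
   one. *)
Definition is_ordinal (x : V) : Prop :=
  transitive_class (ext x) /\ (forall y, y ∈ x -> transitive_class (ext y)).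

Definition ord_le (x y : V) : Prop := ext x `<=` ext y.

Definition is_cardinal (x : V) : Prop :=
  is_ordinal x /\ (forall y, y ∈ x -> ext y #< ext x).

Definition cofinal_in (A : set V) (x : V) : Prop :=
  A `<=` ext x /\ (forall y, y ∈ x -> exists2 z, A z & ord_le y z).

Definition is_regular (x : V) : Prop :=
  [/\ is_cardinal x, infinite_set (ext x) &
      forall A, cofinal_in A x -> A #= ext x].

Definition regular_uncountable (x : V) : Prop :=
  is_regular x /\ ~ countable (ext x).

Definition trcl (x : V) : set V := smallest transitive_class (ext x).

Definition hered (chi : V) : set V := [set x | trcl x #< ext chi].

(* First-order formulas in the language {∈}, with named variables. *)
Inductive formula : Type :=
  | Feq of nat & nat
  | Fin of nat & nat
  | Fnot of formula
  | Fand of formula & formula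
  | Fall of nat & formula.

Definition update (s : nat -> V) (n : nat) (x : V) : nat -> V :=
  fun m => if m == n then x else s m.

Fixpoint sat (A : set V) (phi : formula) (s : nat -> V) : Prop :=
  match phi with
  | Feq i j => s i = s j
  | Fin i j => s i ∈ s j
  | Fnot p => ~ sat A p s
  | Fand p q => sat A p s /\ sat A q s
  | Fall n p => forall x, A x -> sat A p (update s n x)
  end.

Definition elem_sub (N A : set V) : Prop :=
  [/\ N !=set0, N `<=` A &
      forall phi s, (forall n, N (s n)) -> (sat N phi s <-> sat A phi s)].

(* Models with a countable vocabulary; individual constants are 0-ary function
   symbols. *)
Record model (lambda : V) : Type := Model {
  fun_symb : countType;
  fun_arity : fun_symb -> nat;
  rel_symb : countType;
  rel_arity : rel_symb -> nat;
  fun_interp : forall f : fun_symb,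
    (fun_arity f).-tuple (ext lambda) -> ext lambda;
  rel_interp : forall r : rel_symb,
    (rel_arity r).-tuple (ext lambda) -> Prop }.

Definition closed_under lambda (M : model lambda) (b : set V) : Prop :=
  forall (f : fun_symb M) (t : (fun_arity f).-tuple (ext lambda)),
    (forall i, b (val (tnth t i))) -> b (val (fun_interp t)).

Definition cl lambda (M : model lambda) (a : set V) : set V :=
  smallest (closed_under M) a.

Definition Pk (kappa lambda : V) : set (set V) :=
  [set a | a `<=` ext lambda /\ a #< ext kappa].

Definition meets_in_elem (kappa : V) (a : set V) : Prop :=
  exists2 delta, delta ∈ kappa & a `&` ext kappa = ext delta.

Definition club (kappa lambda : V) (M : model lambda) : set (Pk kappa lambda) :=
  [set a | val a = cl M (val a) /\ meets_in_elem kappa (val a)].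

Definition club_filter (kappa lambda : V) : set_system (Pk kappa lambda) :=
  smallest Filter [set X | exists M : model lambda, X = club M].

Arguments club_filter kappa lambda : clear implicits.

Definition empty_mod kappa lambda (E : set_system (Pk kappa lambda))
    (U : set (Pk kappa lambda)) : Prop :=
  E (~` U).

Definition unbounded kappa lambda (U : set (Pk kappa lambda)) : Prop :=
  forall a : Pk kappa lambda, exists2 b, U b & val a `<=` val b.

(* Main.v *)
(** Let [Cstar] be the set of traces [N ∩ λ] provided by the hypothesis, for any
    [chi > λ] and any parameter.  The sets containing all [p ∈ Cstar] above
    some fixed [b ∈ [λ]^{<κ}] form a filter, because a union of two sets of size
    [< κ] has size [< κ].  This filter contains each [C_ζ], as witnessed by
    [b = a_ζ], hence contains every member of [E].  So if the complement of
    [U ⊆ Cstar] is in [E], no member of [U] lies above the corresponding [b],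
    and [U] is not unbounded.  The set-theoretic ingredient is the existence of
    a cardinal [chi > λ], which is obtained as a Hartogs number. *)
Require Import Defs.
From mathcomp Require Import all_boot all_classical.

Local Open Scope classical_set_scope.
Local Open Scope card_scope.

(** * Comparison of cardinalities *)

(** Choice extracts an injection from a relation, which need not be functional; this avoids maps
    between subtypes. *)
Lemma card_leRP {T U : Type} {A : set T} {B : set U} :
  A #<= B <->
  exists R : T -> U -> Prop,
    (forall x, A x -> exists2 y, B y & R x y) /\
    (forall x x' y, A x -> A x' -> R x y -> R x' y -> x = x').
Proof.
split=> [/card_leP[f]|[R [RAB Rinj]]].
  exists (fun x y => exists xA : A x, y = val (f (SigSub (mem_set xA)))).
  split=> [x xA|x x' _ _ _ [xA ->] [x'A /val_inj fxx']].
    by exists (val (f (SigSub (mem_set xA)))); [exact: set_valP|exists xA].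
  by have /(congr1 val) := 'inj_f (in_setT _) (in_setT _) fxx'.
have /choice[f fR] : forall x : A, exists y : B, R (val x) (val y).
  move=> x; have [y yB Rxy] := RAB _ (set_valP x).
  by exists (SigSub (mem_set yB)).
apply/card_leP/injfunPex; exists f => // x x' _ _ fxx'.
apply/val_inj/(Rinj _ _ (val (f x))); [exact: set_valP..|exact: fR|].
by rewrite fxx'; exact: fR.
Qed.

(** By Zorn's lemma there is a maximal partial injection [G]. Were it to miss both some [x] in [A]
    and some [y] in [B], adding [(x, y)] would extend it. *)
Lemma card_le_total {T U : Type} (A : set T) (B : set U) : A #<= B \/ B #<= A.
Proof.
pose P (G : set (T * U)) :=
  [/\ forall p, G p -> A p.1 /\ B p.2,
      forall x x' y, G (x, y) -> G (x', y) -> x = x' &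
      forall x y y', G (x, y) -> G (x, y') -> y = y'].
have [F FP Ftot|G [[GAB Ginj Gfun] Gmax]] := @Zorn_bigcup _ P.
  have F2 p q : (\bigcup_(X in F) X) p -> (\bigcup_(X in F) X) q ->
      exists X, [/\ P X, X p & X q].
    move=> [X FX Xp] [Y FY Yq]; have [XY|YX] := Ftot _ _ FX FY.
      by exists Y; split=> //; [exact: FP|exact: XY].
    by exists X; split=> //; [exact: FP|exact: YX].
  split.
  - by move=> p [X FX Xp]; have [XAB _ _] := FP _ FX; exact: XAB.
  - by move=> x x' y Gp /(F2 _ _ Gp)[X [[_ + _]]]; apply.
  - by move=> x y y' Gp /(F2 _ _ Gp)[X [[_ _]]]; apply.
have [Adom|/existsNP[x /not_implyP[xA xG]]] :=
    pselect (forall x, A x -> exists y, G (x, y)).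
  left; apply/card_leRP; exists (fun x y => G (x, y)).
  split=> [x /Adom[y Gxy]|x x' y _ _]; last exact: Ginj.
  by exists y => //; have [] := GAB _ Gxy.
right; apply/card_leRP; exists (fun y x => G (x, y)).
split=> [y yB|y y' z _ _]; last exact: Gfun.
apply: contrapT => yG; apply: (Gmax (G `|` [set (x, y)])).
  split; first exact: subsetUl.
  by move=> GxyG; apply: xG; exists y; apply: GxyG; right.
have yNG z : ~ G (z, y).
  by move=> Gzy; apply: yG; exists z => //; have [] := GAB _ Gzy.
have xNG z : ~ G (x, z) by move=> Gxz; apply: xG; exists z.
split.
- by move=> p [/GAB//|->].
- move=> u u' v [Guv|[-> ->]] [Gu'v|[]].
  + exact: Ginj Guv Gu'v.
  + by move=> _ vy; case: (yNG u); rewrite -vy.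
  + by case: (yNG u').
  + by move=> ->.
- move=> u v v' [Guv|[-> ->]] [Guv'|[]].
  + exact: Gfun Guv Guv'.
  + by move=> ux _; case: (xNG v); rewrite -ux.
  + by case: (xNG v').
  + by move=> ->.
Qed.

(** * The universe of trees: extensionality, induction, replacement *)

Lemma tree_eq_refl t : tree_eq t t.
Proof. by elim: t => X f IH; split=> i; exists i. Qed.

Lemma tree_eq_sym {s t} : tree_eq s t -> tree_eq t s.
Proof.
elim: s t => X f IH [Y g] [fg gf]; split=> [j|i].
  by have [i] := gf j; exists i; exact: IH.
by have [j] := fg i; exists j; exact: IH.
Qed.

Lemma tree_eq_trans {s t u} : tree_eq s t -> tree_eq t u -> tree_eq s u.
Proof.
elim: s t u => X f IH [Y g] [Z h] [fg gf] [gh hg]; split=> [i|k].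
  have [j ij] := fg i; have [k jk] := gh j.
  by exists k; exact: IH ij jk.
have [j jk] := hg k; have [i ij] := gf j.
by exists i; exact: IH ij jk.
Qed.

Definition set_of_tree (t : tree) : V :=
  MkV (ex_intro _ t (erefl [set s | tree_eq t s])).

Lemma set_of_treeP {s t} : set_of_tree s = set_of_tree t <-> tree_eq s t.
Proof.
split=> [/(congr1 V_class)/= st|st].
  by have : [set u | tree_eq t u] t by [exact: tree_eq_refl]; rewrite -st.
rewrite /set_of_tree; move: (ex_intro _ _ _) => /=; rewrite (_ : [set u | _] =
    [set u | tree_eq t u]); first by move=> p; congr MkV; exact: Prop_irrelevance.
apply/seteqP; split=> u /=; first exact/tree_eq_trans/tree_eq_sym.
exact: tree_eq_trans.
Qed.

Lemma set_of_tree_surj x : exists t, x = set_of_tree t.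
Proof.
case: x => C Cx; have [t Ct] := Cx; exists t; subst C.
by rewrite /set_of_tree; congr MkV; exact: Prop_irrelevance.
Qed.

Lemma ext_set_of_tree X (f : X -> tree) :
  ext (set_of_tree (Tree f)) = range (set_of_tree \o f).
Proof.
apply/seteqP; split=> [x|_ [i _ <-]].
  have [u ->] := set_of_tree_surj x.
  move=> [s [[Y g]]] [/= us [fg gf] [j sj]]; have [i ij] := gf j.
  exists i => //; apply/set_of_treeP; apply: (tree_eq_trans ij).
  exact/tree_eq_sym/(tree_eq_trans us sj).
exists (f i), (Tree f); split; [exact: tree_eq_refl..|].
by exists i; exact: tree_eq_refl.
Qed.

Lemma ext_inj : injective ext.
Proof.
move=> x y; have [[X f] ->] := set_of_tree_surj x.
have [[Y g] ->] := set_of_tree_surj y; rewrite !ext_set_of_tree => fg.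
apply/set_of_treeP; split=> [i|j].
  have : range (set_of_tree \o f) (set_of_tree (f i)) by exists i.
  by rewrite fg => -[j _ /esym/set_of_treeP]; exists j.
have : range (set_of_tree \o g) (set_of_tree (g j)) by exists j.
by rewrite -fg => -[i _ /set_of_treeP]; exists i.
Qed.

Lemma memV_ind (P : V -> Prop) :
  (forall x, (forall y, memV y x -> P y) -> P x) -> forall x, P x.
Proof.
move=> IP x; have [t ->] := set_of_tree_surj x.
elim: t => X f IH; apply: IP => y.
rewrite -[_ ∈ _]/(ext (set_of_tree (Tree f)) y) ext_set_of_tree => -[i _ <-].
exact: IH.
Qed.

Lemma memV_irrefl {x} : ~ memV x x.
Proof. by elim/memV_ind: x => x IH xx; exact: (IH x). Qed.

Lemma ext_range x : exists (X : Type) (f : X -> V), ext x = range f.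
Proof.
have [[X f] ->] := set_of_tree_surj x.
by exists X, (set_of_tree \o f); exact: ext_set_of_tree.
Qed.

(* The sort of [J] must be that of the branching types of [tree]. *)
Lemma replacement {J : Type} {A : set V} (H : V -> J -> Prop) :
  (forall x, A x -> exists j, H x j) ->
  (forall x x' j, A x -> A x' -> H x j -> H x' j -> x = x') ->
  exists v, ext v = A.
Proof.
move=> Htot Hinj.
(* Only the codes in use index branches; over each, choice picks a tree for the element that it
   codes. *)
have /choice[F HF] : forall j : {j | exists2 x, A x & H x j},
    exists t, A (set_of_tree t) /\ H (set_of_tree t) (sval j).
  by case=> j [x]; have [t ->] := set_of_tree_surj x; exists t.
exists (set_of_tree (Tree F)); rewrite ext_set_of_tree.
apply/seteqP; split=> [_ [j _ <-]|x Ax]; first by have [] := HF j.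
have [j Hxj] := Htot x Ax; have jP : exists2 y, A y & H y j by exists x.
have [AF HFj] := HF (exist _ j jP).
by exists (exist _ j jP) => //; exact: Hinj HFj Hxj.
Qed.

(** * Ordinals and Hartogs numbers *)

Lemma mem_ordinal {x y} : is_ordinal x -> memV y x -> is_ordinal y.
Proof.
move=> [xtr yxtr] yx; split; first exact: yxtr.
by move=> z zy; apply: yxtr; exact: xtr zy.
Qed.

(** Nested ∈-induction: when neither ordinal belongs to the other, comparing the elements of each
    with the other shows that they have the same elements. *)
Lemma ordinal_trichotomy {x y} : is_ordinal x -> is_ordinal y ->
  [\/ memV x y, x = y | memV y x].
Proof.
elim/memV_ind: x y => x IHx; elim/memV_ind => y IHy xo yo.
have [//|xNy] := pselect (memV x y); first by constructor 1.
have [//|yNx] := pselect (memV y x); first by constructor 3.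
constructor 2; apply/ext_inj/seteqP; split=> [z zx|z zy].
  have zo := mem_ordinal xo zx; have [//|zy|yz] := IHx z zx y zo yo.
    by case: yNx; rewrite -zy.
  by case: yNx; exact: (xo.1 z zx y).
have zo := mem_ordinal yo zy; have [xz|xz|//] := IHy z zy xo zo.
  by case: xNy; exact: (yo.1 z zy x).
by case: xNy; rewrite xz.
Qed.

Lemma ord_le_total {x y} : is_ordinal x -> is_ordinal y ->
  ord_le x y \/ ord_le y x.
Proof.
move=> xo yo; have [xy|->|yx] := ordinal_trichotomy xo yo.
- by left; exact: yo.1.
- by left.
- by right; exact: xo.1.
Qed.

(* A set of ordinals is coded, along an injection into the index type of the
   tree of [x], by the image of [∈]; a transitive set is determined by its code
   since an isomorphism of transitive sets is the identity. *)
Lemma hartogs x : exists h, ext h = [set y | is_ordinal y /\ ext y #<= ext x].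
Proof.
have [X [f fE]] := ext_range x.
pose coded (R : V -> X -> Prop) y :=
  (forall u, memV u y -> exists p, R u p) /\
  (forall u v p, memV u y -> memV v y -> R u p -> R v p -> u = v).
pose dom (R : V -> X -> Prop) y p := exists2 u, memV u y & R u p.
pose mem (R : V -> X -> Prop) y p q :=
  exists u v, [/\ memV u y, memV v y, R u p, R v q & memV u v].
apply: (@replacement ((X -> Prop) * (X -> X -> Prop))%type _
  (fun y c => exists2 R, coded R y & c = (dom R y, mem R y))).
  move=> y [_ /card_leRP[R [Rtot Rinj]]].
  (* As [f] may repeat values, a member of [y] may have several codes, but no code serves two
     members. *)
  pose S u p := R u (f p).
  exists (dom S y, mem S y), S => //; split.
    move=> u /Rtot[v + Ruv]; rewrite fE => -[p _ pv]; exists p.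
    by rewrite /S pv.
  by move=> u v p uy vy; exact: Rinj.
move=> y y' _ [yo _] [y'o _] [R [Rtot Rinj] ->] [R' [R'tot R'inj]].
case=> domE memE.
(* Members with a common code are equal: by ∈-induction, [memE] matches their elements. *)
have RR' u u' p : memV u y -> memV u' y' -> R u p -> R' u' p -> u = u'.
  elim/memV_ind: u u' p => u IH u' p uy u'y' Rup R'u'p.
  apply/ext_inj/seteqP; split=> [z zu|z' z'u'].
    have zy : memV z y by exact: yo.1 zu.
    have [q Rzq] := Rtot z zy.
    have : mem R y q p by exists z, u.
    rewrite memE => -[z' [w [z'y' wy' R'z'q R'wp]]].
    by rewrite (R'inj _ _ _ wy' u'y' R'wp R'u'p) (IH z zu z' q).
  have z'y' : memV z' y' by exact: y'o.1 z'u'.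
  have [q R'z'q] := R'tot z' z'y'.
  have : mem R' y' q p by exists z', u'.
  rewrite -memE => -[z [w [zy wy Rzq Rwp]]].
  by rewrite (Rinj _ _ _ wy uy Rwp Rup) => zu; rewrite -(IH z zu z' q).
apply/ext_inj/seteqP; split=> [u uy|u' u'y'].
  have [p Rup] := Rtot u uy; have : dom R y p by exists u.
  by rewrite domE => -[u' u'y' R'u'p]; rewrite /ext/= (RR' u u' p).
have [p R'u'p] := R'tot u' u'y'; have : dom R' y' p by exists u'.
by rewrite -domE => -[u uy Rup]; rewrite /ext/= -(RR' u u' p).
Qed.

(** The Hartogs set [chi] of [x] is an ordinal. If it injected into one of its elements, it would
    inject into [x] and so belong to itself. *)
Lemma exists_larger_cardinal {x} : is_ordinal x ->
  exists2 chi, is_cardinal chi & memV x chi.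
Proof.
move=> xo; have [chi chiE] := hartogs x.
have chiP y : memV y chi <-> is_ordinal y /\ ext y #<= ext x.
  by rewrite -[memV y chi]/(ext chi y) chiE.
have chi_tr : transitive_class (ext chi).
  move=> y /chiP[yo yx] z zy; apply/chiP; split; first exact: mem_ordinal zy.
  by apply: card_le_trans yx; apply: subset_card_le; exact: yo.1.
have chio : is_ordinal chi by split=> // y /chiP[[]].
exists chi; last by apply/chiP; split=> //; exact: card_lexx.
split=> // y ychi; split; first by apply: subset_card_le; exact: chi_tr.
move=> chiy; apply: (memV_irrefl (x := chi)); apply/chiP; split=> //.
by apply: card_le_trans chiy _; have [] := (chiP y).1 ychi.
Qed.

(** * Hereditary size and unions of small sets *)

(** A transitive set is its own transitive closure. *)
Lemma hered_transitive {chi x} : transitive_class (ext x) ->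
  ext x #< ext chi -> hered chi x.
Proof. by move=> xtr; rewrite /hered/= /trcl smallest_id. Qed.

(* If [kappa] is regular, neither half of a partition of [kappa] into two small
   pieces is cofinal, so both are bounded by one element of [kappa]. *)
Lemma card_lt_setU {T : Type} {kappa} {A B : set T} : is_regular kappa ->
  A #< ext kappa -> B #< ext kappa -> A `|` B #< ext kappa.
Proof.
move=> [[kappao _] _ kappa_reg] [_ ltA] [_ ltB].
suff ltAB : ~ (ext kappa #<= A `|` B).
  by split=> //; have [|/ltAB] := card_le_total (A `|` B) (ext kappa).
move=> /card_leRP[R [Rtot Rinj]].
(* Otherwise the set [D] of indices related to a point of [C] is cofinal, so of size [kappa] by
   regularity, while [R] injects it into [C]. *)
have bounded C : ~ (ext kappa #<= C) -> exists2 y, memV y kappa &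
    forall z t, memV z kappa -> C t -> R z t -> ~ ord_le y z.
  move=> ltC; apply: contrapT => unb; apply: ltC.
  pose D := [set z | memV z kappa /\ exists2 t, C t & R z t].
  have /kappa_reg : cofinal_in D kappa.
    split=> [z []//|y yk]; apply: contrapT => yD; apply: unb; exists y => //.
    by move=> z t zk Ct Rzt yz; apply: yD; exists z => //; split=> //; exists t.
  rewrite card_eq_le => /andP[_ kD]; apply: card_le_trans kD _.
  apply/card_leRP; exists R; split=> [z [_ [t Ct Rzt]]|z z' t [zk _] [z'k _]].
    by exists t.
  exact: Rinj.
have [y yk yA] := bounded A ltA; have [y' y'k y'B] := bounded B ltB.
(* By symmetry [y'] is the larger bound; a point related to it lies in [A] or [B], against [yA] or
   [y'B]. *)
wlog: A B ltA ltB Rtot y y' yk yA y'k y'B / ord_le y y'.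
  move=> W; have [yy'|y'y] :=
      ord_le_total (mem_ordinal kappao yk) (mem_ordinal kappao y'k).
    exact: (W A B ltA ltB Rtot y y').
  by apply: (W B A ltB ltA _ y' y) => //; rewrite setUC.
move=> yy'; have [t [At|Bt] Ry't] := Rtot y' y'k.
  exact: yA y'k At Ry't yy'.
exact: y'B y'k Bt Ry't _.
Qed.

Theorem theorem2p4 (kappa lambda : V)
    (kappa_reg : regular_uncountable kappa)
    (lambda_card : is_cardinal lambda) (kappa_lambda : ord_le kappa lambda)
    (E E' : set_system (Pk kappa lambda))
    (E_filter : ProperFilter E) (E'_filter : ProperFilter E')
    (club_E : club_filter kappa lambda `<=` E) (E_E' : E `<=` E')
    (mu : V) (mu_ord : is_ordinal mu)
    (C : ext mu -> set (Pk kappa lambda))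
    (C_E' : forall zeta, E' (C zeta))
    (C_gen : E `<=` smallest Filter (range C))
    (a : ext mu -> Pk kappa lambda)
    (models : forall chi : V, is_cardinal chi -> memV lambda chi ->
      forall x : V, hered chi x ->
      E' [set p | exists N : set V,
            [/\ elem_sub N (hered chi), N x, card_lt N (ext kappa),
                meets_in_elem kappa N &
                (forall zeta : ext mu, val (a zeta) `<=` N -> C zeta p) /\
                val p = N `&` ext lambda]]) :
  exists2 Cstar : set (Pk kappa lambda), E' Cstar &
    forall U : set (Pk kappa lambda),
      U `<=` Cstar -> unbounded U -> ~ empty_mod E U.
Proof.
have [lambdao _] := lambda_card.
have [chi chi_card lambda_chi] := exists_larger_cardinal lambdao.
have lambda_hered : hered chi lambda.
  by apply: hered_transitive; [exact: lambdao.1|exact: chi_card.2].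
have := models chi chi_card lambda_chi lambda lambda_hered.
set Cstar := [set p | _] => E'Cstar; exists Cstar => // U UCstar Uunb EU.
pose F : set_system (Pk kappa lambda) := [set X |
  exists b : Pk kappa lambda, forall p, Cstar p -> val b `<=` val p -> X p].
have F_filter : Filter F.
  split.
  (* Some [b] must exist; properness of [E] supplies one. *)
  - have [p _] := @filter_ex _ _ E_filter _ filterT.
    by exists p.
  - move=> X Y [b bX] [c cY].
    have bcP : Pk kappa lambda (val b `|` val c).
      have [bl bk] := set_valP b; have [cl ck] := set_valP c.
      split; first by rewrite subUset.
      exact: card_lt_setU kappa_reg.1 bk ck.
    exists (SigSub (mem_set bcP)) => p Cp /=; rewrite subUset => -[bp cp].
    by split; [exact: bX|exact: cY].
  - by move=> X Y XY [b bX]; exists b => p Cp bp; exact/XY/bX.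
have F_C : range C `<=` F.
  (* Since [p] is the trace of [N], a set [a zeta] below [p] is included in [N], which puts [p] in
     [C zeta]. *)
  move=> _ [zeta _ <-]; exists (a zeta) => p [N [_ _ _ _ [NC pE]]] ap.
  by apply: NC; move: ap; rewrite pE subsetI => -[].
have [b bU] : F (~` U).
  by apply: (smallest_sub F_filter F_C); exact: C_gen EU.
have [p Up bp] := Uunb b.
exact: bU (UCstar p Up) bp Up.
Qed.
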